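(* For every $n\in\mathbb N$ and nonzero complex $x,z$, the Christoffel--Darboux kernel $K^{[n]}(x,y)=A^{[n]}(x^{-1})B^{[n]}(y)$ has the reproducing property $$\oint_{\mathbb T}K^{[n]}(x,y)\,\mathrm d\mu(y)\,K^{[n]}(y,z)=K^{[n]}(x,z).$$ In terms of components, for $a\in\{1,\dots,p\}$ and $d\in\{1,\dots,q\}$, $$\sum_{c=1}^p\sum_{b=1}^q\oint_{\mathbb T}K_{a,b}^{[n]}(x,y)\,\mathrm d\mu_{b,c}(y)\,K_{c,d}^{[n]}(y,z)=K_{a,d}^{[n]}(x,z).$$
   Context: Let $p,q\in\mathbb N$ and let $\mu=(\mu_{b,a})$ be a $q\times p$ matrix of complex Borel measures with infinite support on the unit circle $\mathbb T=\{|z|=1\}$. Rows and columns of semi-infinite matrices are indexed from $0$. For $r\in\mathbb N$, $Z_{[r]}(z)$ is the $\infty\times r$ matrix obtained by stacking the $r\times r$ blocks $I_r, z^{-1}I_r, zI_r, z^{-2}I_r, z^2I_r,\dots$ (block number $2N$ is $z^NI_r$, block number $2N+1$ is $z^{-N-1}I_r$). The moment matrix is $M=\oint_{\mathbb T}Z_{[q]}(z)\,\mathrm d\mu(z)\,Z_{[p]}^\top(z^{-1})$. It is assumed that $M=L^{-1}U^{-1}$ with $L$ lower triangular and $U$ upper triangular semi-infinite matrices with nonzero diagonal entries. Put $B(z)=LZ_{[q]}(z)$ (size $\infty\times q$) and $A(z^{-1})=Z_{[p]}^\top(z^{-1})U$ (size $p\times\infty$). $B^{[n]}$ denotes the first $n$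 rows of $B$ and $A^{[n]}$ the first $n$ columns of $A$; $K^{[n]}(x,y)=A^{[n]}(x^{-1})B^{[n]}(y)$ is a $p\times q$ matrix with entries $K^{[n]}_{a,b}(x,y)$. *)

(* Defs.v *)
From HB Require Import structures.
From mathcomp Require Import all_boot all_order all_algebra.
From mathcomp Require Import complex.
From mathcomp Require Import all_classical all_reals all_analysis.

Set Implicit Arguments.
Unset Strict Implicit.
Unset Printing Implicit Defensive.

Import Order.TTheory GRing.Theory Num.Theory.
Import numFieldNormedType.Exports.

Local Open Scope classical_set_scope.
Local Open Scope ring_scope.
Local Open Scope complex_scope.

(* Complex measures are represented by charges with values in [\bar R[i]]: a
   charge is countably additive and finite on measurable sets, so its values
   there are complex numbers. *)

Section reim_charge.
Context d (T : measurableType d) (R : realType).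

Lemma part_charge_sigma_additive (f : {additive Rcomplex R -> R})
    (nu : {charge set T -> \bar R[i]}) :
    (forall z : R[i], `|f z|%:C <= `|z|) ->
  semi_sigma_additive (fun A => (f (fine (nu A)))%:E).
Proof.
move=> f_norm.
have f_cont (c : R[i]^o) :
    {for c%:E, continuous (fun x : \bar R[i] => (f (fine x))%:E : \bar R)}.
  move=> A /=; rewrite /nbhs /= => /nbhs_ballP[e /= e0 eA].
  apply/nbhs_ballP; exists e%:C => /=; first by rewrite ltcR.
  move=> y /= cy; apply: eA => /=; rewrite /ball /= -raddfB -ltcR.
  exact: le_lt_trans (f_norm _) cy.
move=> F mF tF mUF.
have := @charge_semi_sigma_additive _ _ _ nu F mF tF mUF.
have fin A : measurable A -> nu A = (fine (nu A))%:E.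
  by move=> mA; rewrite fineK//; exact: fin_num_measure.
rewrite (fin _ mUF) => cv.
have := cvg_comp _ _ cv (f_cont (fine (nu (\bigcup_n F n)))).
apply: cvg_trans; apply: near_eq_cvg; apply: nearW => n /=.
rewrite (eq_bigr (fun i => (fine (nu (F i)))%:E)); last by move=> i _; exact: fin.
by rewrite !sumEFin /= raddf_sum.
Qed.

Variable nu : {charge set T -> \bar R[i]}.

Definition Re_charge (A : set T) : \bar R := (complex.Re (fine (nu A)))%:E.

Definition Im_charge (A : set T) : \bar R := (complex.Im (fine (nu A)))%:E.

Let Re_charge0 : Re_charge set0 = 0%E.
Proof. by rewrite /Re_charge charge0. Qed.

Let Re_charge_fin A : measurable A -> Re_charge A \is a fin_num.
Proof. by []. Qed.

Let Re_charge_sigma_additive : semi_sigma_additive Re_charge.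
Proof.
apply: (@part_charge_sigma_additive (@complex.Re R : Rcomplex R -> R)).
exact: normc_ge_Re.
Qed.

HB.instance Definition _ := isCharge.Build _ _ _ Re_charge
  Re_charge0 Re_charge_fin Re_charge_sigma_additive.

Let Im_charge0 : Im_charge set0 = 0%E.
Proof. by rewrite /Im_charge charge0. Qed.

Let Im_charge_fin A : measurable A -> Im_charge A \is a fin_num.
Proof. by []. Qed.

Let Im_charge_sigma_additive : semi_sigma_additive Im_charge.
Proof.
apply: (@part_charge_sigma_additive (@complex.Im R : Rcomplex R -> R)).
by case=> a b; simpc; rewrite -sqrtr_sqr ler_wsqrtr // lerDr sqr_ge0.
Qed.

HB.instance Definition _ := isCharge.Build _ _ _ Im_charge
  Im_charge0 Im_charge_fin Im_charge_sigma_additive.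

End reim_charge.

Section complex_integral.
Context d (T : measurableType d) (R : realType).

Definition hahn_sets (nu : {charge set T -> \bar R}) :
    {PN : set T * set T | hahn_decomposition nu PN.1 PN.2}.
Proof.
by apply: cid; have [P [N h]] := Hahn_decomposition nu; exists (P, N).
Qed.

(* The value does not depend on the choice of the Hahn decomposition. *)
Definition charge_integral (nu : {charge set T -> \bar R}) (f : T -> R) : R :=
  \int[jordan_pos (svalP (hahn_sets nu))]_x f x -
  \int[jordan_neg (svalP (hahn_sets nu))]_x f x.

Definition complex_integral (nu : {charge set T -> \bar R[i]})
    (f : T -> R[i]) : R[i] :=
  (charge_integral (Re_charge nu) (@complex.Re R \o f) -
   charge_integral (Im_charge nu) (@complex.Im R \o f)) +i*
  (charge_integral (Im_charge nu) (@complex.Re R \o f) +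
   charge_integral (Re_charge nu) (@complex.Im R \o f)).

End complex_integral.

Section circle.
Variable R : realType.

Definition unit_circle : set R[i]^o := [set z | `|z| = 1].

Definition circle : Type := unit_circle.

HB.instance Definition _ := Topological.on circle.

Let circle1 : (1 : R[i]^o) \in unit_circle.
Proof. by rewrite inE /unit_circle /= normr1. Qed.

HB.instance Definition _ := isPointed.Build circle (exist _ (1 : R[i]^o) circle1).

Definition borel_circle := g_sigma_algebraType (@open circle).

Definition circle_val (u : borel_circle) : R[i] := set_val (u : circle).

End circle.

Definition circle_measure (R : realType) :=
  {charge set (borel_circle R) -> \bar R[i]}.

Section circle_integral.
Variable R : realType.

(* the support of the total variation of [nu] *)
Definition measure_support (nu : circle_measure R) : set (circle R) :=
  [set u | forall U : set (circle R), open U -> U u ->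
     exists A : set (borel_circle R),
       [/\ measurable A, A `<=` U & nu A != 0%E]].

Definition oint (nu : circle_measure R) (f : R[i] -> R[i]) : R[i] :=
  complex_integral nu (f \o @circle_val R).

(* the matrix of integrals of F(y) dmu(y) G(y) over the circle *)
Definition oint_mx (q p : nat) (mu : 'I_q -> 'I_p -> circle_measure R)
    (I J : Type) (F : R[i] -> I -> 'I_q -> R[i]) (G : R[i] -> 'I_p -> J -> R[i])
    : I -> J -> R[i] := fun i j =>
  \sum_(b < q) \sum_(a < p) oint (mu b a) (fun y => F y i b * G y a j).

End circle_integral.

Section semi_infinite.
Variable R : nzRingType.

(* The entries are finitely supported sums (the sum is [0] by convention if
   infinitely many terms are nonzero), which is the intended product whenever
   [A] has finitely many nonzero entries in each row or [B] in each column. *)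
Definition sinf_mul (I J : Type) (A : I -> nat -> R) (B : nat -> J -> R)
    : I -> J -> R := fun i j => \sum_(k \in [set: nat]) A i k * B k j.

Definition sinf_id (i j : nat) : R := (i == j)%:R.

Definition sinf_tr (I J : Type) (A : I -> J -> R) : J -> I -> R :=
  fun j i => A i j.

(* If [A] is triangular with an invertible diagonal, there is exactly one such
   [B], and it is triangular on the same side as [A]. *)
Definition sinf_inverse (A B : nat -> nat -> R) : Prop :=
  sinf_mul A B = sinf_id /\ sinf_mul B A = sinf_id.

Definition lower_triangular (A : nat -> nat -> R) : Prop :=
  forall i j, (i < j)%N -> A i j = 0.

Definition upper_triangular (A : nat -> nat -> R) : Prop :=
  forall i j, (j < i)%N -> A i j = 0.

End semi_infinite.

Section christoffel_darboux.
Variable R : realType.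
Local Notation C := R[i].

(* 1, z^-1, z, z^-2, z^2, etc *)
Definition Zpow (k : nat) (z : C) : C :=
  if odd k then z ^- (k./2).+1 else z ^+ k./2.

Definition Zmx (r : nat) (z : C) : nat -> 'I_r -> C :=
  fun i a => if (i %% r == a)%N then Zpow (i %/ r) z else 0.

Variables p q : nat.

Definition moment_matrix (mu : 'I_q -> 'I_p -> circle_measure R)
    : nat -> nat -> C :=
  oint_mx mu (fun z => @Zmx q z) (fun z => sinf_tr (@Zmx p z^-1)).

Variables L U : nat -> nat -> C.

Definition Bmx (z : C) : nat -> 'I_q -> C := sinf_mul L (@Zmx q z).

(* The argument [w] stands for z^-1: A(z^-1) is [Amx z^-1]. *)
Definition Amx (w : C) : 'I_p -> nat -> C := sinf_mul (sinf_tr (@Zmx p w)) U.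

Definition Btrunc (n : nat) (z : C) : 'M[C]_(n, q) := \matrix_(i, b) Bmx z i b.

Definition Atrunc (n : nat) (w : C) : 'M[C]_(p, n) := \matrix_(a, j) Amx w a j.

Definition CDkernel (n : nat) (x y : C) : 'M[C]_(p, q) :=
  Atrunc n x^-1 *m Btrunc n y.

End christoffel_darboux.

Arguments CDkernel {R} p q L U n x y.

(* Main.v *)
(** Since L M U = I for the moment matrix M, the rows of B and the columns of A
    are biorthogonal: the integral of B_k(y) dmu(y) A_l(y^-1) is the Kronecker
    delta.  Expanding both kernels as sums of products of A and B, the integral
    then collapses the double sum to a single one.  Everything integrated is a
    trigonometric polynomial, so integration is linear on it because such
    functions are bounded and Borel measurable on the circle. *)

Require Import Defs.
From HB Require Import structures.
From mathcomp Require Import all_boot all_order all_algebra.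
From mathcomp Require Import complex.
From mathcomp Require Import all_classical all_reals all_analysis.
From mathcomp Require Import measurable_realfun ring.

Set Implicit Arguments.
Unset Strict Implicit.
Unset Printing Implicit Defensive.

Import Order.TTheory GRing.Theory Num.Theory.
Import numFieldNormedType.Exports.

Local Open Scope classical_set_scope.
Local Open Scope ring_scope.
Local Open Scope complex_scope.

(** * Linearity of integration against complex measures, on bounded measurable functions *)

Section bounded_measurable.
Context d (T : measurableType d) (R : realType).

(** This class is stable under sums and products, and all its members are integrable against any
    finite measure, so integrability is never checked function by function. *)
Definition bounded_measurable (f : T -> R) : Prop :=
  measurable_fun setT f /\ exists M, forall u, `|f u| <= M.

Lemma bounded_measurableD f g : bounded_measurable f -> bounded_measurable g ->
  bounded_measurable (fun u => f u + g u).
Proof.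
move=> [mf [M fM]] [mg [N gN]]; split; first exact: measurable_funD.
by exists (M + N) => u; apply: le_trans (ler_normD _ _) (lerD _ _).
Qed.

Lemma bounded_measurableM f g : bounded_measurable f -> bounded_measurable g ->
  bounded_measurable (fun u => f u * g u).
Proof.
move=> [mf [M fM]] [mg [N gN]]; split; first exact: measurable_funM.
by exists (M * N) => u; rewrite normrM ler_pM.
Qed.

Lemma bounded_measurable_cst c : bounded_measurable (fun=> c).
Proof. by split; [exact: measurable_cst | exists `|c|]. Qed.

Lemma bounded_measurableN f : bounded_measurable f ->
  bounded_measurable (fun u => - f u).
Proof.
move=> /(bounded_measurableM (bounded_measurable_cst (-1))).
by congr bounded_measurable; apply/funext => u; rewrite mulN1r.
Qed.

Lemma bounded_measurable_integrable (mu : {finite_measure set T -> \bar R}) f :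
  bounded_measurable f -> mu.-integrable setT (EFin \o f).
Proof.
move=> [mf [M fM]]; apply: measurable_bounded_integrable => //.
  by rewrite ltey_eq fin_num_measure.
exists M; split=> [|N MN u _ /=]; first exact: num_real.
exact: le_trans (fM u) (ltW MN).
Qed.

(** Both Jordan parts of a charge are finite measures, so each of the two integrals in the
    difference is additive on bounded measurable functions. *)
Lemma charge_integralD (nu : {charge set T -> \bar R}) f g :
  bounded_measurable f -> bounded_measurable g ->
  charge_integral nu (fun u => f u + g u) =
  charge_integral nu f + charge_integral nu g.
Proof.
move=> bf bg; rewrite /charge_integral.
by rewrite !RintegralD//; first ring; exact: bounded_measurable_integrable.
Qed.

Lemma charge_integralZ (nu : {charge set T -> \bar R}) c f :
  bounded_measurable f ->
  charge_integral nu (fun u => c * f u) = c * charge_integral nu f.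
Proof.
move=> bf; rewrite /charge_integral.
by rewrite !RintegralZl//; first ring; exact: bounded_measurable_integrable.
Qed.

Definition complex_bounded_measurable (f : T -> R[i]) : Prop :=
  bounded_measurable (@complex.Re R \o f) /\
  bounded_measurable (@complex.Im R \o f).

Lemma complex_bounded_measurableD f g :
  complex_bounded_measurable f -> complex_bounded_measurable g ->
  complex_bounded_measurable (fun u => f u + g u).
Proof.
move=> [rf jf] [rg jg]; split.
- have := bounded_measurableD rf rg; congr bounded_measurable.
  by apply/funext => u /=; rewrite raddfD.
- have := bounded_measurableD jf jg; congr bounded_measurable.
  by apply/funext => u /=; rewrite raddfD.
Qed.

Lemma ReM (z w : R[i]) :
  complex.Re (z * w) = complex.Re z * complex.Re w - complex.Im z * complex.Im w.
Proof. by case: z w => [a b] [e f]. Qed.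

Lemma ImM (z w : R[i]) :
  complex.Im (z * w) = complex.Re z * complex.Im w + complex.Im z * complex.Re w.
Proof. by case: z w => [a b] [e f]. Qed.

Lemma complex_bounded_measurableM f g :
  complex_bounded_measurable f -> complex_bounded_measurable g ->
  complex_bounded_measurable (fun u => f u * g u).
Proof.
move=> [rf jf] [rg jg]; split.
- have := bounded_measurableD (bounded_measurableM rf rg)
    (bounded_measurableN (bounded_measurableM jf jg)); congr bounded_measurable.
  by apply/funext => u /=; rewrite ReM.
- have := bounded_measurableD (bounded_measurableM rf jg)
    (bounded_measurableM jf rg); congr bounded_measurable.
  by apply/funext => u /=; rewrite ImM.
Qed.

Lemma complex_bounded_measurable_cst c :
  complex_bounded_measurable (fun=> c).
Proof. by split; exact: bounded_measurable_cst. Qed.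

Lemma complex_bounded_measurableX f k : complex_bounded_measurable f ->
  complex_bounded_measurable (fun u => f u ^+ k).
Proof.
move=> bf; elim: k => [|k IH]; first exact: complex_bounded_measurable_cst.
have := complex_bounded_measurableM bf IH.
by congr complex_bounded_measurable; apply/funext => u; rewrite exprS.
Qed.

Lemma complex_bounded_measurable_sum (I : Type) (r : seq I) (f : I -> T -> R[i]) :
  (forall i, complex_bounded_measurable (f i)) ->
  complex_bounded_measurable (fun u => \sum_(i <- r) f i u).
Proof.
move=> bf; elim: r => [|i r IH].
  have := complex_bounded_measurable_cst 0.
  by congr complex_bounded_measurable; apply/funext => u; rewrite big_nil.
have := complex_bounded_measurableD (bf i) IH.
by congr complex_bounded_measurable; apply/funext => u; rewrite big_cons.
Qed.

Variable nu : {charge set T -> \bar R[i]}.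

Lemma complex_integralD f g :
  complex_bounded_measurable f -> complex_bounded_measurable g ->
  complex_integral nu (fun u => f u + g u) =
  complex_integral nu f + complex_integral nu g.
Proof.
move=> [rf jf] [rg jg]; rewrite /complex_integral.
have -> : @complex.Re R \o (fun u => f u + g u) =
    (fun u => (@complex.Re R \o f) u + (@complex.Re R \o g) u).
  by apply/funext => u /=; rewrite raddfD.
have -> : @complex.Im R \o (fun u => f u + g u) =
    (fun u => (@complex.Im R \o f) u + (@complex.Im R \o g) u).
  by apply/funext => u /=; rewrite raddfD.
rewrite !charge_integralD//.
by apply/eqP; rewrite eq_complex /=; apply/andP; split; apply/eqP; ring.
Qed.

(** A complex scalar mixes the real and imaginary parts of [f], so real additivity and real
    homogeneity are both used on each component. *)
Lemma complex_integralZ c f : complex_bounded_measurable f ->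
  complex_integral nu (fun u => c * f u) = c * complex_integral nu f.
Proof.
move=> [rf jf]; rewrite /complex_integral.
have bZ a h : bounded_measurable h -> bounded_measurable (fun u => a * h u).
  exact: bounded_measurableM (bounded_measurable_cst a).
have -> : @complex.Re R \o (fun u => c * f u) =
    (fun u => complex.Re c * (@complex.Re R \o f) u +
              - complex.Im c * (@complex.Im R \o f) u).
  by apply/funext => u /=; rewrite ReM mulNr.
have -> : @complex.Im R \o (fun u => c * f u) =
    (fun u => complex.Re c * (@complex.Im R \o f) u +
              complex.Im c * (@complex.Re R \o f) u).
  by apply/funext => u /=; rewrite ImM.
rewrite !charge_integralD ?charge_integralZ//; try exact: bZ.
case: c => a b /=.
by apply/eqP; rewrite eq_complex /=; apply/andP; split; apply/eqP; ring.
Qed.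

Lemma complex_integral_sum (I : Type) (r : seq I) (f : I -> T -> R[i]) :
  (forall i, complex_bounded_measurable (f i)) ->
  complex_integral nu (fun u => \sum_(i <- r) f i u) =
  \sum_(i <- r) complex_integral nu (f i).
Proof.
move=> bf; elim: r => [|i r IH].
  (* The integral of the zero function vanishes by homogeneity with scalar 0. *)
  rewrite big_nil -[RHS](mul0r (complex_integral nu (fun=> 0))).
  rewrite -complex_integralZ; last exact: complex_bounded_measurable_cst.
  by congr complex_integral; apply/funext => u; rewrite big_nil mul0r.
rewrite big_cons -IH -complex_integralD//; last exact: complex_bounded_measurable_sum.
by congr complex_integral; apply/funext => u; rewrite big_cons.
Qed.

End bounded_measurable.

(** * Trigonometric polynomials on the unit circle and bilinearity of the matrix integral *)

Section circle.
Variable R : realType.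
Local Notation C := R[i].

Lemma Re_continuous : continuous (@complex.Re R : C^o -> R).
Proof.
move=> z A /nbhs_ballP[e /= e0 eA]; apply/nbhs_ballP.
exists e%:C => /=; first by rewrite ltcR.
move=> w /= zw; apply: eA; rewrite /ball /= -raddfB -ltcR.
exact: le_lt_trans (normc_ge_Re _) zw.
Qed.

Lemma Im_continuous : continuous (@complex.Im R : C^o -> R).
Proof.
move=> z A /nbhs_ballP[e /= e0 eA]; apply/nbhs_ballP.
exists e%:C => /=; first by rewrite ltcR.
move=> w /= zw; apply: eA; rewrite /ball /= -raddfB -ltcR.
apply: le_lt_trans zw; case: (z - w) => a b; simpc.
by rewrite -sqrtr_sqr ler_wsqrtr // lerDr sqr_ge0.
Qed.

Lemma measurable_circle_comp (f : C^o -> R) :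
  continuous f -> measurable_fun setT (f \o @circle_val R).
Proof.
move=> /continuousP cf; apply: (measurability _ (RGenOpens.measurableE R)).
move=> _ [_ [a [b ->] <-]]; rewrite setTI; apply: sub_sigma_algebra.
(* Open sets of the circle are traces of open sets of the plane; the witness is the open planar set
   whose trace is the required preimage. *)
by exists (f @^-1` `]a, b[%classic) => //; exact/cf/interval_open.
Qed.

Lemma circle_val_norm (u : borel_circle R) : `|circle_val u| = 1.
Proof. by case: u => z /= hz; have := set_mem hz. Qed.

Lemma circle_val_bounded_measurable :
  complex_bounded_measurable (@circle_val R).
Proof.
split; split.
- exact: measurable_circle_comp Re_continuous.
- exists 1 => u /=; rewrite -lecR; apply: le_trans (normc_ge_Re _) _.
  by rewrite circle_val_norm.
- exact: measurable_circle_comp Im_continuous.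
- exists 1 => u /=; rewrite -lecR.
  have -> : 1%:C = `|circle_val u| by rewrite circle_val_norm.
  case: (circle_val u) => a b; simpc.
  by rewrite -sqrtr_sqr ler_wsqrtr // lerDr sqr_ge0.
Qed.

(** On the circle [z] times its conjugate is [|z|^2 = 1], so inversion is conjugation. Measurability
    of the inverse thus follows from that of the real and imaginary parts, without dealing with the
    pole at 0. *)
Lemma circle_val_inv (u : borel_circle R) :
  (circle_val u)^-1 = complex.Re (circle_val u) -i* complex.Im (circle_val u).
Proof.
have := circle_val_norm u; have := normCK (circle_val u) => + E.
rewrite E expr1n => /esym uc.
have u0 : circle_val u != 0 by rewrite -normr_gt0 E ltr01.
by apply: (mulfI u0); rewrite divff// -uc; case: (circle_val u).
Qed.

Lemma circle_val_inv_bounded_measurable :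
  complex_bounded_measurable (fun u => (@circle_val R u)^-1).
Proof.
have [bR bI] := circle_val_bounded_measurable; split.
- move: bR; congr bounded_measurable; apply/funext => u /=.
  by rewrite circle_val_inv.
- have := bounded_measurableN bI; congr bounded_measurable.
  by apply/funext => u /=; rewrite circle_val_inv.
Qed.

(** Each entry is 0 or an integer power of [z]. The statement at [z^-1] serves the right factor of
    the moment matrix and the functions [Amx]. *)
Lemma Zmx_bounded_measurable (r i : nat) (a : 'I_r) :
  complex_bounded_measurable (fun u => Zmx (@circle_val R u) i a) /\
  complex_bounded_measurable (fun u => Zmx (@circle_val R u)^-1 i a).
Proof.
rewrite /Zmx; case: (i %% r == a)%N;
  last by split; exact: complex_bounded_measurable_cst.
have bX k := complex_bounded_measurableX k circle_val_bounded_measurable.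
have bV k := complex_bounded_measurableX k circle_val_inv_bounded_measurable.
rewrite /Zpow; case: (odd _); split => //.
- have := bV (i %/ r)./2.+1; congr complex_bounded_measurable.
  by apply/funext => u; rewrite exprVn.
- have := bX (i %/ r)./2.+1; congr complex_bounded_measurable.
  by apply/funext => u; rewrite exprVn invrK.
Qed.

(** Constant matrices on the outside of the integrand leave the integral. This is applied twice:
    with coefficients [L] and [U] around the moment matrix, and with coefficients [Amx U x^-1] and
    [Bmx L z] around the biorthogonality integrals. *)
Lemma oint_mx_bilinear (q p m n : nat) (mu : 'I_q -> 'I_p -> circle_measure R)
    (I J : Type) (F : C -> nat -> 'I_q -> C) (G : C -> 'I_p -> nat -> C)
    (P : I -> nat -> C) (Q : nat -> J -> C) (i : I) (j : J) :
  (forall k b, complex_bounded_measurable (fun u => F (@circle_val R u) k b)) ->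
  (forall a l, complex_bounded_measurable (fun u => G (@circle_val R u) a l)) ->
  oint_mx mu (fun y i b => \sum_(k < m) P i k * F y k b)
             (fun y a j => \sum_(l < n) G y a l * Q l j) i j =
  \sum_(k < m) \sum_(l < n) P i k * oint_mx mu F G k l * Q l j.
Proof.
move=> bF bG; rewrite /oint_mx.
transitivity (\sum_(b < q) \sum_(a < p) \sum_(k < m) \sum_(l < n)
    P i k * Q l j * oint (mu b a) (fun y => F y k b * G y a l)).
  apply: eq_bigr => b _; apply: eq_bigr => a _; rewrite /oint.
  have bFG k l := complex_bounded_measurableM (bF k b) (bG a l).
  have bZ c k l := complex_bounded_measurableM
    (complex_bounded_measurable_cst _ c) (bFG k l).
  transitivity (complex_integral (mu b a) (fun u => \sum_(k < m) \sum_(l < n)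
      P i k * Q l j * (F (circle_val u) k b * G (circle_val u) a l))).
    congr complex_integral; apply/funext => u /=.
    rewrite big_distrlr /=; apply: eq_bigr => k _; apply: eq_bigr => l _; ring.
  rewrite complex_integral_sum; last first.
    by move=> k; apply: complex_bounded_measurable_sum => l; exact: bZ.
  apply: eq_bigr => k _; rewrite complex_integral_sum; last by move=> l; exact: bZ.
  by apply: eq_bigr => l _; rewrite complex_integralZ.
(* The sums over [k] and [l] are moved outside those over [b] and [a], so that the inner double sum
   becomes an entry of [oint_mx mu F G]. *)
under eq_bigr => b _ do (rewrite exchange_big /=;
  under eq_bigr => k _ do rewrite exchange_big /=).
rewrite exchange_big /=; apply: eq_bigr => k _.
rewrite exchange_big /=; apply: eq_bigr => l _.
rewrite mulr_sumr mulr_suml; apply: eq_bigr => b _.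
by rewrite mulr_sumr mulr_suml; apply: eq_bigr => a _; ring.
Qed.

End circle.

(** * Products and inverses of triangular semi-infinite matrices *)

(** The vanishing tail makes the support finite, so the default value 0 for infinite supports does
    not interfere. The cutoff [m] need not be sharp, which allows one common cutoff for several
    products. *)
Lemma sinf_mul_sum (R : nzRingType) (I J : Type) (A : I -> nat -> R)
    (B : nat -> J -> R) (i : I) (j : J) (m : nat) :
  (forall k, (m <= k)%N -> A i k * B k j = 0) ->
  sinf_mul A B i j = \sum_(k < m) A i k * B k j.
Proof.
move=> AB0; rewrite /sinf_mul (fsbig_ord _ _ (fun k => A i k * B k j)).
apply/esym; apply: fsbig_widen => // k [_ /= /negP].
by rewrite -leqNgt => /AB0.
Qed.

(** Forward substitution: by strong induction on the row [i] in a fixed column [j], the entry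
    [(i, j)] of [A B = I] above the diagonal reduces to [A i i * B i j = 0]. *)
Lemma lower_triangular_inverse (F : fieldType) (A B : nat -> nat -> F) :
  lower_triangular A -> (forall i, A i i != 0) -> sinf_inverse A B ->
  lower_triangular B.
Proof.
move=> lA A0 [AB _] + j; elim/ltn_ind => i IH ij.
have := congr1 (fun M => M i j) AB; rewrite /sinf_id (ltn_eqF ij).
rewrite (@sinf_mul_sum _ _ _ _ _ _ _ i.+1); last first.
  by move=> k ik; rewrite lA ?mul0r.
rewrite big_ord_recr big1 => [|k _] /=; last first.
  by rewrite IH ?mulr0// (ltn_trans _ ij).
by rewrite add0r => /eqP; rewrite mulf_eq0 (negPf (A0 i)) => /eqP.
Qed.

(** * Biorthogonality and the reproducing property *)

Section christoffel_darboux.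
Variables (R : realType) (p q : nat) (L U : nat -> nat -> R[i]).
Local Notation C := R[i].
Hypotheses (hL : lower_triangular L) (hU : upper_triangular U).

Lemma Bmx_sum n y k (b : 'I_q) : (k < n)%N ->
  Bmx L y k b = \sum_(i < n) L k i * Zmx y i b.
Proof.
move=> kn; apply: sinf_mul_sum => i ni.
by rewrite hL ?mul0r// (leq_trans kn).
Qed.

Lemma Amx_sum n w (a : 'I_p) l : (l < n)%N ->
  Amx U w a l = \sum_(j < n) Zmx w j a * U j l.
Proof.
move=> ln; apply: sinf_mul_sum => j nj.
by rewrite hU ?mulr0// (leq_trans ln).
Qed.

Lemma Bmx_bounded_measurable k (b : 'I_q) :
  complex_bounded_measurable (fun u => Bmx L (@circle_val R u) k b).
Proof.
have : complex_bounded_measurable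
    (fun u => \sum_(i < k.+1) L k i * Zmx (@circle_val R u) i b).
  apply: complex_bounded_measurable_sum => i.
  apply: complex_bounded_measurableM; first exact: complex_bounded_measurable_cst.
  by have [] := @Zmx_bounded_measurable R q i b.
by congr complex_bounded_measurable; apply/funext => u; rewrite -Bmx_sum.
Qed.

Lemma Amx_bounded_measurable (a : 'I_p) l :
  complex_bounded_measurable (fun u => Amx U (@circle_val R u)^-1 a l).
Proof.
have : complex_bounded_measurable
    (fun u => \sum_(j < l.+1) Zmx (@circle_val R u)^-1 j a * U j l).
  apply: complex_bounded_measurable_sum => j.
  apply: complex_bounded_measurableM; last exact: complex_bounded_measurable_cst.
  by have [] := @Zmx_bounded_measurable R p j a.
by congr complex_bounded_measurable; apply/funext => u; rewrite -Amx_sum.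
Qed.

Variables (mu : 'I_q -> 'I_p -> circle_measure R) (Linv Uinv : nat -> nat -> C).
Hypothesis hLd : forall i, L i i != 0.
Hypotheses (hLinv : sinf_inverse L Linv) (hUinv : sinf_inverse U Uinv).
Hypothesis hM : moment_matrix mu = sinf_mul Linv Uinv.

(** The integral is the entry [(k, l)] of [L M U] with [M = Linv Uinv]. Triangularity cuts every sum
    at a common [n], so the regrouping into [(L Linv) (Uinv U)] only exchanges finite sums. *)
Lemma biorthogonality k l :
  oint_mx mu (fun y => @Bmx R q L y) (fun y => @Amx R p U y^-1) k l
  = (k == l)%:R.
Proof.
(* Beyond both indices: row [k] of [L] and column [l] of [U] vanish from [n] on. *)
pose n := (maxn k l).+1.
have kn : (k < n)%N by rewrite ltnS leq_maxl.
have ln : (l < n)%N by rewrite ltnS leq_maxr.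
have lLinv := lower_triangular_inverse hL hLd hLinv.
transitivity (oint_mx mu
    (fun y i b => \sum_(i' < n) L i i' * @Zmx R q y i' b)
    (fun y a j => \sum_(j' < n) sinf_tr (@Zmx R p y^-1) a j' * U j' j) k l).
  rewrite /oint_mx; apply: eq_bigr => b _; apply: eq_bigr => a _.
  by congr oint; apply/funext => y; rewrite (Bmx_sum _ _ kn) (Amx_sum _ _ ln).
rewrite (@oint_mx_bilinear _ _ _ _ _ mu _ _ (@Zmx R q)
  (fun y => sinf_tr (@Zmx R p y^-1)) L U); first last.
- by move=> a j; have [] := @Zmx_bounded_measurable R p j a.
- by move=> i b; have [] := @Zmx_bounded_measurable R q i b.
transitivity (\sum_(i < n) \sum_(j < n) \sum_(m < n)
    (L k i * Linv i m) * (Uinv m j * U j l)).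
  apply: eq_bigr => i _; apply: eq_bigr => j _.
  have := congr1 (fun M => M (i : nat) (j : nat)) hM.
  rewrite /moment_matrix => ->.
  (* The moment with indices [i, j < n] is also a sum cut at [n], because [Linv] is lower triangular
     and [i < n]. *)
  rewrite (@sinf_mul_sum _ _ _ _ _ _ _ n); last first.
    by move=> m nm; rewrite lLinv ?mul0r// (leq_trans (ltn_ord i)).
  by rewrite mulr_sumr mulr_suml; apply: eq_bigr => m _; ring.
under eq_bigr => i _ do rewrite exchange_big /=.
rewrite exchange_big /=.
(* The truncated sum is already the full entry of [L Linv], since the nonzero part of row [k] of [L]
   lies below [n]; likewise for column [l] of [U] in [UU]. *)
have LL m : \sum_(i < n) L k i * Linv i m = (k == m)%:R.
  have [+ _] := hLinv; move=> /(congr1 (fun M => M k m)); rewrite /sinf_id => <-.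
  rewrite (@sinf_mul_sum _ _ _ _ _ _ _ n)// => i ni.
  by rewrite hL ?mul0r// (leq_trans kn).
have UU m : \sum_(j < n) Uinv m j * U j l = (m == l)%:R.
  have [_ +] := hUinv; move=> /(congr1 (fun M => M m l)); rewrite /sinf_id => <-.
  rewrite (@sinf_mul_sum _ _ _ _ _ _ _ n)// => j nj.
  by rewrite hU ?mulr0// (leq_trans ln).
transitivity (\sum_(m < n) (k == m :> nat)%:R * (m == l :> nat)%:R : C).
  by apply: eq_bigr => m _; rewrite -big_distrlr /= LL UU.
rewrite (bigD1 (Ordinal kn)) //= eqxx mul1r big1 ?addr0// => m mk.
by rewrite (_ : (k == m) = false) ?mul0r//; apply: contraNF mk => /eqP km; apply/eqP/val_inj.
Qed.

Lemma CDkernelE n x y a b :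
  CDkernel p q L U n x y a b = \sum_(k < n) Amx U x^-1 a k * Bmx L y k b.
Proof. by rewrite mxE; apply: eq_bigr => k _; rewrite !mxE. Qed.

Lemma CDkernel_reproducing n x z a d :
  oint_mx mu (fun y => CDkernel p q L U n x y)
             (fun y => CDkernel p q L U n y z) a d
  = CDkernel p q L U n x z a d.
Proof.
transitivity (oint_mx mu
    (fun y a b => \sum_(k < n) Amx U x^-1 a k * @Bmx R q L y k b)
    (fun y c d => \sum_(l < n) @Amx R p U y^-1 c l * Bmx L z l d) a d).
  rewrite /oint_mx; apply: eq_bigr => b _; apply: eq_bigr => c _.
  by congr oint; apply/funext => y; rewrite !CDkernelE.
(* The factors at [x] and [z] do not depend on the integration variable [y]; what stays under the
   integral is the biorthogonal pair. *)
rewrite (@oint_mx_bilinear _ _ _ _ _ mu _ _ (@Bmx R q L)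
  (fun y => @Amx R p U y^-1) (Amx U x^-1) (Bmx L z)); first last.
- exact: Amx_bounded_measurable.
- exact: Bmx_bounded_measurable.
rewrite CDkernelE; apply: eq_bigr => k _.
(* For fixed [k] only the term [l = k] survives, with coefficient 1. *)
rewrite (bigD1 k) //= biorthogonality eqxx mulr1 big1 ?addr0// => l lk.
by rewrite biorthogonality eq_sym (negPf (_ : l != k :> nat)%N)// mulr0 mul0r.
Qed.

End christoffel_darboux.

Theorem theorem2p42 (R : realType) (p q : nat) (hp : (0 < p)%N) (hq : (0 < q)%N)
    (mu : 'I_q -> 'I_p -> circle_measure R)
    (hmu : forall b a, infinite_set (measure_support (mu b a)))
    (L U Linv Uinv : nat -> nat -> R[i])
    (hL : lower_triangular L) (hLd : forall i, L i i != 0)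
    (hU : upper_triangular U) (hUd : forall i, U i i != 0)
    (hLinv : sinf_inverse L Linv) (hUinv : sinf_inverse U Uinv)
    (hM : moment_matrix mu = sinf_mul Linv Uinv)
    (n : nat) (x z : R[i]) (hx : x != 0) (hz : z != 0) :
  \matrix_(a, d) oint_mx mu (fun y => CDkernel p q L U n x y)
                            (fun y => CDkernel p q L U n y z) a d
    = CDkernel p q L U n x z
  /\
  (forall (a : 'I_p) (d : 'I_q),
     \sum_(c < p) \sum_(b < q)
        oint (mu b c)
          (fun y => CDkernel p q L U n x y a b * CDkernel p q L U n y z c d)
     = CDkernel p q L U n x z a d).
Proof.
have repr a d := CDkernel_reproducing hL hU hLd hLinv hUinv hM n x z a d.
split; first by apply/matrixP => a d; rewrite mxE.
(* The component formula sums over [c] outside [b], whereas [oint_mx] nests them the other way. *)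
by move=> a d; rewrite -repr /oint_mx exchange_big.
Qed.
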